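(* Let $S=\Bbbk[x_1,\ldots,x_n]$ with $\Bbbk$ a field, let $M$ be a finitely generated $\mathbb Z^n$-graded $S$-module, and let $\mathbf a\in\mathbb Z^n$. If all nonzero Betti numbers $\beta_{i,\mathbf b}(M)$ lie in degrees $\mathbf b\preceq\mathbf a$, then for every $i$ the local cohomology $H^i_{\mathfrak m}(M)$ can only be nonzero in $\mathbb Z^n$-degrees $\preceq\mathbf a-\mathbf 1$.
   Context: $\mathfrak m=\langle x_1,\ldots,x_n\rangle$, $\mathbf 1=(1,\ldots,1)$, and $\preceq$ is the coordinatewise partial order on $\mathbb Z^n$. $S$ is $\mathbb Z^n$-graded with $\mathbf x^{\mathbf b}$ in degree $\mathbf b$. The Betti numbers are $\beta_{i,\mathbf b}(M)=\dim_\Bbbk\mathrm{Tor}_i^S(\Bbbk,M)_{\mathbf b}$. *)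

(* Defs.v *)
From HB Require Import structures.
From mathcomp Require Import all_boot all_order all_algebra.
From mathcomp Require Import mpoly.

Set Implicit Arguments.
Unset Strict Implicit.
Unset Printing Implicit Defensive.

Import GRing.Theory.

Local Open Scope ring_scope.

Definition coord_le (n : nat) (b a : 'rV[int]_n) : Prop :=
  forall j : 'I_n, b ord0 j <= a ord0 j.

Definition mnm_degree (n : nat) (u : 'X_{1..n}) : 'rV[int]_n :=
  \row_(j < n) (u j)%:Z.

(* The homogeneous components are subgroups [gm_deg b] whose internal direct
   sum is the whole module.  Taking [u = 0] in [gm_degZ] makes each component
   stable under the scalars of [k]. *)
Record gradedModule (k : fieldType) (n : nat) := GradedModule {
  gm_mod :> lmodType {mpoly k[n]};
  gm_deg : 'rV[int]_n -> gm_mod -> Prop;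
  gm_deg0 : forall b, gm_deg b 0;
  gm_degD : forall b v w, gm_deg b v -> gm_deg b w -> gm_deg b (v + w);
  gm_degZ : forall b (c : k) (u : 'X_{1..n}) v,
    gm_deg b v -> gm_deg (b + mnm_degree u) ((c *: 'X_[u]) *: v);
  gm_deg_span : forall v, exists (s : seq 'rV[int]_n) (f : 'rV[int]_n -> gm_mod),
    (forall b, gm_deg b (f b)) /\ v = \sum_(b <- s) f b;
  gm_deg_free : forall (s : seq 'rV[int]_n) (f : 'rV[int]_n -> gm_mod),
    uniq s -> (forall b, gm_deg b (f b)) -> \sum_(b <- s) f b = 0 ->
    forall b, b \in s -> f b = 0
}.

Section GradedModules.

Variables (k : fieldType) (n : nat).

Local Notation S := {mpoly k[n]}.
Local Notation gmod := (gradedModule k n).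

Definition degree_preserving (A B : gmod) (f : {linear A -> B}) : Prop :=
  forall b v, gm_deg b v -> gm_deg b (f v).

Definition finitely_generated (M : gmod) : Prop :=
  exists (r : nat) (g : 'I_r -> M),
    forall v, exists c : 'I_r -> S, v = \sum_(i < r) c i *: g i.

Definition graded_free (F : gmod) : Prop :=
  exists (J : eqType) (e : J -> F),
    [/\ forall j, exists b, gm_deg b (e j),
        forall v, exists (s : seq J) (c : J -> S), v = \sum_(j <- s) c j *: e j
      & forall (s : seq J) (c : J -> S), uniq s ->
          \sum_(j <- s) c j *: e j = 0 -> forall j, j \in s -> c j = 0].

(* Injective objects of the category of graded modules and degree-preserving
   maps; they need not be injective as ungraded modules. *)
Definition graded_injective (E : gmod) : Prop :=
  forall (A B : gmod) (h : {linear A -> B}) (f : {linear A -> E}),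
    degree_preserving h -> degree_preserving f -> injective h ->
    exists g : {linear B -> E}, degree_preserving g /\ (forall v, g (h v) = f v).

Record free_resolution (M : gmod) := FreeResolution {
  fr_mod :> nat -> gmod;
  fr_d : forall i, {linear fr_mod i.+1 -> fr_mod i};
  fr_aug : {linear fr_mod 0%N -> M};
  fr_free : forall i, graded_free (fr_mod i);
  fr_d_deg : forall i, degree_preserving (fr_d i);
  fr_aug_deg : degree_preserving fr_aug;
  fr_aug_surj : forall v, exists z, fr_aug z = v;
  fr_exact0 : forall z, fr_aug z = 0 <-> exists w, fr_d 0 w = z;
  fr_exact : forall i z, fr_d i z = 0 <-> exists w, fr_d i.+1 w = z
}.

Record injective_resolution (M : gmod) := InjectiveResolution {
  ir_mod :> nat -> gmod;
  ir_d : forall i, {linear ir_mod i -> ir_mod i.+1};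
  ir_aug : {linear M -> ir_mod 0%N};
  ir_inj : forall i, graded_injective (ir_mod i);
  ir_d_deg : forall i, degree_preserving (ir_d i);
  ir_aug_deg : degree_preserving ir_aug;
  ir_aug_inj : injective ir_aug;
  ir_exact0 : forall z, ir_d 0 z = 0 <-> exists v, ir_aug v = z;
  ir_exact : forall i z, ir_d i.+1 z = 0 <-> exists w, ir_d i w = z
}.

Definition in_maxideal (p : S) : Prop :=
  exists q : 'I_n -> S, p = \sum_(j < n) q j * 'X_j.

Definition in_maxideal_mul (M : gmod) (v : M) : Prop :=
  exists (r : nat) (p : 'I_r -> S) (f : 'I_r -> M),
    (forall l, in_maxideal (p l)) /\ v = \sum_(l < r) p l *: f l.

(* [v] is killed by some power of the maximal ideal, that power being generated
   by the products of [t] elements of the ideal. *)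
Definition maxideal_torsion (M : gmod) (v : M) : Prop :=
  exists t : nat, forall p : 'I_t -> S,
    (forall l, in_maxideal (p l)) -> (\prod_(l < t) p l) *: v = 0.

(* [Z / B] has dimension [d] over [k], for subspaces [B] of [Z]. *)
Definition subquotient_dim (M : gmod) (Z B : M -> Prop) (d : nat) : Prop :=
  exists v : 'I_d -> M,
    [/\ forall l, Z (v l),
        forall z, Z z -> exists c : 'I_d -> k,
          B (z - \sum_(l < d) (c l)%:MP *: v l)
      & forall c : 'I_d -> k,
          B (\sum_(l < d) (c l)%:MP *: v l) -> forall l, c l = 0].

(* Tor(k, M) is the homology of [k (x) F], and [k (x) F_i = F_i / m F_i] because
   [k = S / m].  Cycles and boundaries are represented by elements of [F_i]. *)
Definition tor_cycle (M : gmod) (F : free_resolution M) (i : nat)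
    (b : 'rV[int]_n) : F i -> Prop :=
  match i return F i -> Prop with
  | 0%N => fun z => gm_deg b z
  | j.+1 => fun z => gm_deg b z /\ in_maxideal_mul (fr_d F j z)
  end.

Definition tor_boundary (M : gmod) (F : free_resolution M) (i : nat)
    (b : 'rV[int]_n) (z : F i) : Prop :=
  gm_deg b z /\
  exists w : F i.+1, gm_deg b w /\ in_maxideal_mul (z - fr_d F i w).

(* [betti M i b d] reads: the Betti number of [M] in homological degree [i] and
   degree [b] equals [d]; it does not depend on the resolution. *)
Definition betti (M : gmod) (i : nat) (b : 'rV[int]_n) (d : nat) : Prop :=
  exists F : free_resolution M,
    subquotient_dim (@tor_cycle M F i b) (@tor_boundary M F i b) d.

(* Local cohomology is the right derived functor of the torsion functor, hence
   the cohomology of the torsion subcomplex of an injective resolution; its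
   grading comes from the resolution being graded. *)
Definition loccoh_cocycle (M : gmod) (I : injective_resolution M) (i : nat)
    (b : 'rV[int]_n) (z : I i) : Prop :=
  [/\ gm_deg b z, maxideal_torsion z & ir_d I i z = 0].

Definition loccoh_coboundary (M : gmod) (I : injective_resolution M) (i : nat)
    (b : 'rV[int]_n) : I i -> Prop :=
  match i return I i -> Prop with
  | 0%N => fun z => z = 0
  | j.+1 => fun z => exists w : I j,
      [/\ gm_deg b w, maxideal_torsion w & ir_d I j w = z]
  end.

Definition local_cohomology_nonzero (M : gmod) (i : nat) (b : 'rV[int]_n) : Prop :=
  exists (I : injective_resolution M) (z : I i),
    loccoh_cocycle b z /\ ~ loccoh_coboundary b z.

End GradedModules.

(* Main.v *)
Require Import Defs.
From Stdlib Require Import Classical IndefiniteDescription.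
From HB Require Import structures.
From mathcomp Require Import all_boot all_order all_algebra.
From mathcomp Require Import mpoly zify ring.

(* Fix a coordinate [j] and suppose [a_j <= c_j].  Only the vanishing of [Tor_0]
   and [Tor_1] in degrees [b] with [b_j > a_j] matters: by graded Nakayama [M] is
   generated, with relations generated, in degrees whose [j]-th coordinate is at
   most [a_j], so [x_j : M_b -> M_(b + e_j)] is bijective whenever [b_j >= a_j].

   Let [J] be the exact complex [0 -> M -> I^0 -> I^1 -> ...] and let [J^L_c] be
   its subcomplex of elements of degree [c] killed by [x_m^t] for all [m] in [L].
   Injectivity makes [x_l^t : J^L_c -> J^L_(c + t e_l)] surjective in the terms
   [I^i] when [l] is not in [L].  In the term [M] it is bijective for [L] empty
   and [l = j], and both sides vanish as soon as [L] contains [j].  Hence, adding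
   [j] first, all the [J^L_c] with [c_j >= a_j] are exact by induction on [L].
   A torsion cocycle is killed by [x_m^t] for all [m] and some [t], so it is the
   differential of an element killed by the same powers, which is torsion. *)

Set Implicit Arguments.
Unset Strict Implicit.
Unset Printing Implicit Defensive.

Import Order.TTheory GRing.Theory Num.Theory.

Local Open Scope ring_scope.

(** Serves to merge repeated keys, since [gm_deg_free] and freeness speak only of duplicate-free
    lists. *)
Lemma sum_by_key (K : eqType) (V W : zmodType) (l : seq (K * V))
    (Phi : K -> V -> W) :
  (forall k, Phi k 0 = 0) -> (forall k, {morph Phi k : x y / x + y}) ->
  \sum_(x <- l) Phi x.1 x.2 =
  \sum_(k <- undup [seq x.1 | x <- l]) Phi k (\sum_(x <- l | x.1 == k) x.2).
Proof.
move=> Phi0 PhiD.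
under [RHS]eq_bigr => k _ do rewrite (big_morph _ (PhiD k) (Phi0 k)).
rewrite (exchange_big_dep xpredT) //=.
apply: eq_big_seq => x xl.
rewrite big_mkcond (bigD1_seq x.1) ?undup_uniq ?mem_undup ?map_f //= eqxx.
by rewrite big1 ?addr0 // => k; rewrite eq_sym => /negPf->.
Qed.

Lemma mnm_degreeD n (u v : 'X_{1..n}) :
  mnm_degree (u + v)%MM = mnm_degree u + mnm_degree v.
Proof. by apply/rowP=> i; rewrite !mxE mnmDE PoszD. Qed.

Lemma mnm_degree0 n : mnm_degree (0%MM : 'X_{1..n}) = 0.
Proof. by apply/rowP=> i; rewrite !mxE mnm0E. Qed.

(** * Homogeneous components *)

Section Graded.
Variables (k : fieldType) (n : nat).
Local Notation S := {mpoly k[n]}.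
Local Notation gmod := (gradedModule k n).
Local Notation deg := 'rV[int]_n.

Section Components.
Variable A : gmod.
Implicit Types (b : deg) (v w : A).

Lemma gm_degC b (c : k) v : gm_deg b v -> gm_deg b (c%:MP *: v).
Proof.
by move=> /(gm_degZ c 0%MM); rewrite mnm_degree0 addr0 mpolyX0 -mul_mpolyC mulr1.
Qed.

Lemma gm_degX b (u : 'X_{1..n}) v :
  gm_deg b v -> gm_deg (b + mnm_degree u) ('X_[u] *: v).
Proof. by move=> /(gm_degZ 1 u); rewrite scale1r. Qed.

Lemma gm_degN b v : gm_deg b v -> gm_deg b (- v).
Proof. by move=> /(gm_degC (-1)); rewrite mpolyCN scaleN1r. Qed.

Lemma gm_degB b v w : gm_deg b v -> gm_deg b w -> gm_deg b (v - w).
Proof. by move=> bv bw; apply: gm_degD => //; apply: gm_degN. Qed.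

Lemma gm_deg_sum b (I : Type) (r : seq I) (P : pred I) (F : I -> A) :
  (forall i, P i -> gm_deg b (F i)) -> gm_deg b (\sum_(i <- r | P i) F i).
Proof. by move=> bF; elim/big_ind: _ => //; [exact: gm_deg0 | exact: gm_degD]. Qed.

(** Graded modules come without projections, so a vanishing component in degree [b] is expressed by
    a decomposition that avoids [b]. *)
Definition off_degree b v := exists2 l : seq (deg * A),
  (forall x, x \in l -> x.1 != b /\ gm_deg x.1 x.2) & v = \sum_(x <- l) x.2.

Lemma off_degree_hom b b' v : b' != b -> gm_deg b' v -> off_degree b v.
Proof.
move=> b'b b'v; exists [:: (b', v)]; last by rewrite big_seq1.
by move=> x; rewrite inE => /eqP->.
Qed.

Lemma off_degree0 b : off_degree b 0.
Proof. by exists [::]; rewrite ?big_nil. Qed.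

Lemma off_degreeD b v w : off_degree b v -> off_degree b w -> off_degree b (v + w).
Proof.
move=> [l hl ->] [m hm ->]; exists (l ++ m); last by rewrite big_cat.
by move=> x; rewrite mem_cat => /orP[/hl|/hm].
Qed.

Lemma off_degree_sum b (I : Type) (r : seq I) (P : pred I) (F : I -> A) :
  (forall i, P i -> off_degree b (F i)) -> off_degree b (\sum_(i <- r | P i) F i).
Proof.
by move=> bF; elim/big_ind: _ => //; [exact: off_degree0 | exact: off_degreeD].
Qed.

(** Prepending [-v] in degree [b] to the decomposition gives a vanishing sum whose degree [b] part
    is [-v] alone, so directness applies. *)
Lemma off_degree_eq0 b v : off_degree b v -> gm_deg b v -> v = 0.
Proof.
move=> [l hl ->] bv.
pose m := (b, - \sum_(x <- l) x.2) :: l.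
pose s := undup [seq x.1 | x <- m].
pose f (d : deg) := \sum_(x <- m | x.1 == d) x.2.
have fdeg d : gm_deg d (f d).
  rewrite /f big_seq_cond; apply: gm_deg_sum => x /andP[]; rewrite inE.
  case/orP=> [/eqP -> /= /eqP <-|/hl[_ hx] /eqP <- //]; exact: gm_degN.
have f0 : \sum_(d <- s) f d = 0.
  rewrite -(sum_by_key m (Phi := fun=> id)) // big_cons /=.
  by rewrite addNr.
have /(_ b) := gm_deg_free (undup_uniq _) fdeg f0.
rewrite /s mem_undup inE eqxx => /(_ isT).
have E : \sum_(x <- l | x.1 == b) x.2 = 0.
  by rewrite big1_seq // => x /andP[/eqP xb /hl[]]; rewrite xb eqxx.
by rewrite /f big_cons /= eqxx E addr0 => /eqP; rewrite oppr_eq0 => /eqP.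
Qed.

Lemma hom_component b v : exists2 w, gm_deg b w & off_degree b (v - w).
Proof.
have [s [f [fdeg ->]]] := gm_deg_span v.
exists (\sum_(d <- s | d == b) f d).
  by apply: gm_deg_sum => d /eqP <-.
rewrite (bigID (pred1 b)) /= addrAC subrr add0r.
by apply: off_degree_sum => d db; apply: off_degree_hom db (fdeg d).
Qed.

End Components.

Lemma off_degree_map (A B : gmod) (f : {linear A -> B}) b v :
  degree_preserving f -> off_degree b v -> off_degree b (f v).
Proof.
move=> fdeg [l hl ->]; rewrite raddf_sum big_seq_cond.
apply: off_degree_sum => x; rewrite andbT => /hl[xb xdeg].
by apply: off_degree_hom xb (fdeg _ _ xdeg).
Qed.

(** The degree [b] component of [z] works: the rest of [z] maps off degree [b], while the difference
    of the two images has degree [b]. *)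
Lemma homogeneous_lift (A B : gmod) (f : {linear A -> B}) b z :
  degree_preserving f -> gm_deg b (f z) -> exists2 z', gm_deg b z' & f z' = f z.
Proof.
move=> fdeg bfz; have [w bw off] := hom_component b z; exists w => //.
apply/eqP; rewrite -subr_eq0 -opprB oppr_eq0 -raddfB; apply/eqP.
apply: off_degree_eq0 (off_degree_map fdeg off) _.
by rewrite raddfB; apply: gm_degB => //; apply: fdeg.
Qed.

End Graded.

(** * Monomials indexed by integer vectors *)

Section Degrees.
Variables (k : fieldType) (n : nat).
Local Notation S := {mpoly k[n]}.
Local Notation deg := 'rV[int]_n.
Implicit Types (d : deg) (u : 'X_{1..n}) (p q : S).

Definition nonneg d := [forall l, 0 <= d ord0 l].

Definition mnm_of d : 'X_{1..n} := [multinom `|d ord0 l|%N | l < n].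

(** With the value 0 outside the nonnegative orthant, the degree [b] part of a free module with
    generator in degree [d] is always spanned by [mono k (b - d)]. *)
Definition mono d : S := if nonneg d then 'X_[mnm_of d] else 0.

Definition coefd d p : k := if nonneg d then p@_(mnm_of d) else 0.

Lemma nonneg_mnm_degree u : nonneg (mnm_degree u).
Proof. by apply/forallP=> l; rewrite mxE. Qed.

Lemma mnm_degreeK : cancel (@mnm_degree n) mnm_of.
Proof. by move=> u; apply/mnmP=> l; rewrite mnmE mxE. Qed.

Lemma mnm_ofK d : nonneg d -> mnm_degree (mnm_of d) = d.
Proof.
by move=> /forallP d0; apply/rowP=> l; rewrite mxE mnmE gez0_abs.
Qed.

Lemma nonnegD d u : nonneg d -> nonneg (d + mnm_degree u).
Proof.
move=> /forallP d0; apply/forallP=> l; rewrite !mxE.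
have := d0 l => /=; lia.
Qed.

Lemma mono_mnm_degree u : mono (mnm_degree u) = 'X_[u].
Proof. by rewrite /mono nonneg_mnm_degree mnm_degreeK. Qed.

Lemma monoD d u : nonneg d -> mono (d + mnm_degree u) = 'X_[u] * mono d.
Proof.
move=> d0; rewrite -{1}(mnm_ofK d0) -mnm_degreeD mono_mnm_degree.
by rewrite addmC mpolyXD /mono d0.
Qed.

Lemma nonneg_subU d (j : 'I_n) :
  nonneg d -> 0 < d ord0 j -> nonneg (d - mnm_degree U_(j)).
Proof.
move=> /forallP d0 dj; apply/forallP=> l; rewrite !mxE mnm1E.
by have := d0 l; case: eqP => [<-|_] /=; move: dj => /=; lia.
Qed.

Lemma mono_subU d (j : 'I_n) : nonneg d -> 0 < d ord0 j ->
  mono d = 'X_j * mono (d - mnm_degree U_(j)).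
Proof. by move=> d0 dj; rewrite -monoD ?nonneg_subU // subrK. Qed.

Lemma coefdB d : {morph coefd d : p q / p - q}.
Proof. by move=> p q; rewrite /coefd; case: ifP => _; rewrite ?subr0 ?mcoeffB. Qed.

Lemma coefd_sum d (I : Type) (r : seq I) (F : I -> S) :
  coefd d (\sum_(i <- r) F i) = \sum_(i <- r) coefd d (F i).
Proof.
rewrite /coefd; case: ifP => _; first by rewrite raddf_sum.
by rewrite big1.
Qed.

Lemma coefdZ_mono d c : nonneg d -> coefd d (c *: mono d) = c.
Proof. by move=> d0; rewrite /coefd /mono d0 mcoeffZ mcoeffX eqxx mulr1. Qed.

Lemma coefd_eq0 d p : ~~ nonneg d -> coefd d p = 0.
Proof. by rewrite /coefd => /negPf->. Qed.

Lemma coefd_XM d (j : 'I_n) p :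
  coefd d ('X_j * p) = coefd (d - mnm_degree U_(j)) p.
Proof.
case d0: (nonneg (d - mnm_degree U_(j))).
  have dE : d = mnm_degree (U_(j) + mnm_of (d - mnm_degree U_(j)))%MM.
    by rewrite mnm_degreeD mnm_ofK // addrC subrK.
  by rewrite {1}dE /coefd d0 nonneg_mnm_degree mnm_degreeK mulrC mcoeffMX.
rewrite [RHS]coefd_eq0 ?d0 // /coefd; case: ifP => // dge0.
apply/eqP; rewrite mcoeff_eq0 mulrC (perm_mem (msuppMX _ _)).
apply/negP => /mapP[u _ E]; move/negP: d0; apply.
rewrite -(mnm_ofK dge0) E mnm_degreeD addrAC subrr add0r.
exact: nonneg_mnm_degree.
Qed.

End Degrees.

Section Maxideal.
Variables (k : fieldType) (n : nat).
Local Notation S := {mpoly k[n]}.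

Lemma in_maxidealM (p : S) (j : 'I_n) : in_maxideal ('X_j * p).
Proof.
exists (fun l => if l == j then p else 0).
rewrite (bigD1 j) //= eqxx mulrC big1 ?addr0 // => l /negPf->.
by rewrite mul0r.
Qed.

Lemma in_maxideal_mulP (M : gradedModule k n) (v : M) :
  in_maxideal_mul v -> exists w : 'I_n -> M, v = \sum_l 'X_l *: w l.
Proof.
move=> [r [p [f [pm ->]]]].
have [q qE] := functional_choice _ pm.
exists (fun l => \sum_(i < r) q i l *: f i).
under [RHS]eq_bigr => l _ do rewrite scaler_sumr.
rewrite exchange_big; apply: eq_bigr => i _; rewrite qE scaler_suml.
by apply: eq_bigr => l _; rewrite scalerA mulrC.
Qed.

End Maxideal.

(** [rel] is the graph of the map: pairs of combinations with equal coefficients. Freeness makes it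
    single-valued, and choice turns it into a function. *)
Lemma free_lift (R : pzRingType) (F P : lmodType R) (J : eqType) (e : J -> F)
    (t : J -> P) :
  (forall v, exists (s : seq J) (c : J -> R), v = \sum_(j <- s) c j *: e j) ->
  (forall (s : seq J) (c : J -> R), uniq s ->
     \sum_(j <- s) c j *: e j = 0 -> forall j, j \in s -> c j = 0) ->
  exists phi : {linear F -> P}, forall j, phi (e j) = t j.
Proof.
move=> span free.
pose rel z p := exists2 l : seq (J * R),
  z = \sum_(x <- l) x.2 *: e x.1 & p = \sum_(x <- l) x.2 *: t x.1.
have relD z p z' p' : rel z p -> rel z' p' -> rel (z + z') (p + p').
  by move=> [l -> ->] [l' -> ->]; exists (l ++ l'); rewrite big_cat.
have relZ c z p : rel z p -> rel (c *: z) (c *: p).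
  move=> [l -> ->]; exists [seq (x.1, c * x.2) | x <- l];
    by rewrite big_map scaler_sumr; apply: eq_bigr => x _; rewrite scalerA.
have rel0 p : rel 0 p -> p = 0.
  have scale_key (V : lmodType R) (f : J -> V) l : \sum_(x <- l) x.2 *: f x.1 =
      \sum_(j <- undup [seq x.1 | x <- l]) (\sum_(x <- l | x.1 == j) x.2) *: f j.
    apply: (sum_by_key l (Phi := fun j c => c *: f j)) => j.
      exact: scale0r.
    by move=> c c'; exact: scalerDl.
  move=> [l]; rewrite scale_key => /esym/free.
  rewrite undup_uniq scale_key => /(_ isT) l0 ->.
  by rewrite big1_seq // => j /andP[_ /l0->]; rewrite scale0r.
have rel_fun z p p' : rel z p -> rel z p' -> p = p'.
  move=> zp /(relZ (-1)) /(relD _ _ _ _ zp); rewrite !scaleN1r subrr.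
  by move=> /rel0/eqP; rewrite subr_eq0 => /eqP.
have /functional_choice[phi phiE] z : exists p, rel z p.
  have [s [c ->]] := span z; exists (\sum_(j <- s) c j *: t j).
  by exists [seq (j, c j) | j <- s]; rewrite big_map.
have phi_lin : linear phi.
  move=> c z z'; apply: rel_fun (phiE _) _.
  by apply: relD => //; apply: relZ.
pose lphi : {linear F -> P} := HB.pack phi (GRing.isLinear.Build _ _ _ _ phi phi_lin).
exists lphi => j; apply: rel_fun (phiE _) _.
by exists [:: (j, 1)]; rewrite big_seq1 scale1r.
Qed.

(** * Combinations of homogeneous elements *)

Section Combinations.
Variables (k : fieldType) (n : nat) (M : gradedModule k n).
Local Notation S := {mpoly k[n]}.
Local Notation deg := 'rV[int]_n.
Implicit Types (b d : deg) (v w : M) (p : S).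

Lemma gm_deg_mono b d c v :
  gm_deg d v -> gm_deg b ((c *: mono k (b - d)) *: v).
Proof.
move=> dv; rewrite /mono; case: ifP => bd0; last first.
  by rewrite scaler0 scale0r; apply: gm_deg0.
have bE : b = d + mnm_degree (mnm_of (b - d)) by rewrite mnm_ofK // addrC subrK.
rewrite [X in gm_deg X _]bE.
exact: gm_degZ.
Qed.

Lemma off_degreeM b d p v :
  gm_deg d v -> coefd (b - d) p = 0 -> off_degree b (p *: v).
Proof.
move=> dv p0; rewrite (mpolyE p) scaler_suml big_seq_cond.
apply: off_degree_sum => u; rewrite andbT mcoeff_msupp => pu.
apply: off_degree_hom (gm_degZ _ _ dv).
apply: contraNneq pu => duE; move: p0.
by rewrite -duE addrAC subrr add0r /coefd nonneg_mnm_degree mnm_degreeK => ->.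
Qed.

Lemma coefd_sub_mono d p : coefd d (p - coefd d p *: mono k d) = 0.
Proof.
rewrite coefdB; case d0: (nonneg d); first by rewrite coefdZ_mono ?subrr.
by rewrite !coefd_eq0 ?d0 ?subrr.
Qed.

(** Each coefficient is cut down to its monomial of degree [b - gam i]. The discarded part is off
    degree [b], yet also of degree [b] as the difference of the two sides. *)
Lemma homogeneous_combination (r : nat) (gam : 'I_r -> deg) (g : 'I_r -> M)
    (p : 'I_r -> S) b :
  (forall i, gm_deg (gam i) (g i)) -> gm_deg b (\sum_i p i *: g i) ->
  \sum_i p i *: g i =
  \sum_i (coefd (b - gam i) (p i) *: mono k (b - gam i)) *: g i.
Proof.
move=> gdeg bv; apply/eqP; rewrite -subr_eq0; apply/eqP.
apply: (@off_degree_eq0 _ _ _ b).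
  rewrite -sumrB; apply: off_degree_sum => i _; rewrite -scalerBl.
  by apply: off_degreeM (gdeg i) _; apply: coefd_sub_mono.
by apply: gm_degB => //; apply: gm_deg_sum => i _; apply: gm_deg_mono.
Qed.

Section Span.
Variables (r : nat) (g : 'I_r -> M).

Definition in_span v := exists c : 'I_r -> S, v = \sum_i c i *: g i.

Lemma in_span0 : in_span 0.
Proof. by exists (fun=> 0); rewrite big1 // => i _; rewrite scale0r. Qed.

Lemma in_spanD v w : in_span v -> in_span w -> in_span (v + w).
Proof.
move=> [c ->] [c' ->]; exists (fun i => c i + c' i).
by rewrite -big_split; apply: eq_bigr => i _; rewrite scalerDl.
Qed.

Lemma in_spanZ a v : in_span v -> in_span (a *: v).
Proof.
move=> [c ->]; exists (fun i => a * c i).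
by rewrite scaler_sumr; apply: eq_bigr => i _; rewrite scalerA.
Qed.

Lemma in_span_sum (J : Type) (s : seq J) (P : pred J) (F : J -> M) :
  (forall i, P i -> in_span (F i)) -> in_span (\sum_(i <- s | P i) F i).
Proof. by move=> gF; elim/big_ind: _ => //; [exact: in_span0 | exact: in_spanD]. Qed.

Definition generates := forall v, in_span v.

End Span.

(** The homogeneous components of the given generators, collected in one list, generate. *)
Lemma homogeneous_generators : finitely_generated M ->
  exists (r : nat) (gam : 'I_r -> deg) (g : 'I_r -> M),
    (forall i, gm_deg (gam i) (g i)) /\ generates g.
Proof.
move=> [r [g gen]].
pose spanned (l : seq (deg * M)) :=
  in_span (fun i : 'I_(size l) => (nth (0, 0) l i).2).
have spanned_mem l x : x \in l -> spanned l x.2.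
  move=> xl; exists (fun i => (val i == index x l)%:R).
  rewrite (bigD1 (Ordinal (etrans (index_mem x l) xl))) //= eqxx scale1r nth_index //.
  rewrite big1 ?addr0 // => i; rewrite -val_eqE => /= /negPf->.
  by rewrite scale0r.
have spanned_sub l l' v : {subset l <= l'} -> spanned l v -> spanned l' v.
  move=> ll' [c ->]; apply: in_span_sum => i _.
  exact/in_spanZ/spanned_mem/ll'/mem_nth.
have [l [hom sp]] : exists l : seq (deg * M),
    (forall x, x \in l -> gm_deg x.1 x.2) /\ forall i, spanned l (g i).
  suff [l [hom sp]] : exists l : seq (deg * M),
      (forall x, x \in l -> gm_deg x.1 x.2) /\
      forall i, i \in enum 'I_r -> spanned l (g i).
    by exists l; split=> // i; apply: sp; rewrite mem_enum.
  elim: (enum 'I_r) => [|i s [l [hom sp]]]; first by exists [::]; split.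
  have [s' [f [fdeg gE]]] := gm_deg_span (g i).
  exists ([seq (d, f d) | d <- s'] ++ l); split=> [x|i'].
    by rewrite mem_cat => /orP[/mapP[d _ ->]|/hom].
  rewrite inE => /orP[/eqP->|/sp]; last first.
    by apply: spanned_sub => x xl; rewrite mem_cat xl orbT.
  rewrite gE big_seq_cond; apply: in_span_sum => d; rewrite andbT => ds'.
  apply: (spanned_mem _ (d, f d)).
  by rewrite mem_cat map_f.
exists (size l), (fun i => (nth (0, 0) l i).1), (fun i => (nth (0, 0) l i).2).
split=> [i|v]; first exact/hom/mem_nth.
have [c ->] := gen v; apply: in_span_sum => i _; exact/in_spanZ/sp.
Qed.

End Combinations.

(** * Generators and relations from Tor_0 and Tor_1 *)

Section Presentation.
Variables (k : fieldType) (n : nat) (M : gradedModule k n).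
Local Notation S := {mpoly k[n]}.
Local Notation deg := 'rV[int]_n.
Implicit Types (b d : deg) (v w : M) (p : S).

(** Dividing by a variable lowers it by one and the generators bound it from below, so it drives the
    graded Nakayama inductions. *)
Definition total d : int := \sum_l d ord0 l.

Lemma total_ge0 d : nonneg d -> 0 <= total d.
Proof. by move=> /forallP d0; apply: sumr_ge0. Qed.

Lemma totalB b d : total (b - d) = total b - total d.
Proof. by rewrite /total -sumrB; apply: eq_bigr => l _; rewrite !mxE. Qed.

Lemma total_U (j : 'I_n) : total (mnm_degree U_(j)) = 1.
Proof.
rewrite /total (bigD1 j) //= mxE mnm1E eqxx big1 ?addr0 // => l /negPf lj.
by rewrite mxE mnm1E eq_sym lj.
Qed.

Lemma total_lower_bound (r : nat) (gam : 'I_r -> deg) :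
  exists low : int, forall i, low <= total (gam i).
Proof.
exists (- \sum_i `|total (gam i)|) => i; rewrite lerNl.
apply: le_trans (_ : `|total (gam i)| <= _).
  by rewrite -normrN ler_norm.
by rewrite (bigD1 i) //= lerDl sumr_ge0.
Qed.

Lemma lt_low_bound (low m : int) : exists N : nat, m < low + N%:Z.
Proof. by exists (`|m| + `|low| + 1)%N; lia. Qed.

Lemma off_degreeX b (u : 'X_{1..n}) v :
  off_degree b v -> off_degree (b + mnm_degree u) ('X_[u] *: v).
Proof.
move=> [l hom ->]; rewrite scaler_sumr big_seq_cond.
apply: off_degree_sum => x; rewrite andbT => /hom[xb xdeg].
by apply: off_degree_hom (gm_degX u xdeg); rewrite (inj_eq (addIr _)).
Qed.

Lemma homogeneous_maxideal_mul b v : gm_deg b v -> in_maxideal_mul v ->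
  exists2 w : 'I_n -> M, forall l, gm_deg (b - mnm_degree U_(l)) (w l) &
    v = \sum_l 'X_l *: w l.
Proof.
move=> bv /in_maxideal_mulP[w vE].
have /(functional_choice _)[w' w'P] l :
    exists x, gm_deg (b - mnm_degree U_(l)) x /\
              off_degree (b - mnm_degree U_(l)) (w l - x).
  by have [x] := hom_component (b - mnm_degree U_(l)) (w l); exists x.
exists w' => [l|]; first by have [] := w'P l.
apply/eqP; rewrite -subr_eq0; apply/eqP; apply: (@off_degree_eq0 _ _ _ b).
  rewrite vE -sumrB; apply: off_degree_sum => l _; rewrite -scalerBr.
  by have [_ /(off_degreeX U_(l))] := w'P l; rewrite subrK.
apply: gm_degB => //; apply: gm_deg_sum => l _.
by have [/(gm_degX U_(l))] := w'P l; rewrite subrK.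
Qed.

(** A degree [b] lift of [v] to [F_0] is a boundary, that is, congruent modulo [m F_0] to a
    differential, which the augmentation kills. *)
Lemma betti0_maxideal_mul b v :
  betti M 0 b 0 -> gm_deg b v -> in_maxideal_mul v.
Proof.
move=> [F [e [_ span _]]] bv.
have [z zE] := fr_aug_surj F v.
have [|z' bz' z'E] := homogeneous_lift (z := z) (@fr_aug_deg _ _ _ F) (b := b).
  by rewrite zE.
have [c] := span _ bz'; rewrite big_ord0 subr0 => -[_ [w [_]]].
move=> [r [p [f [pm fE]]]]; exists r, p, (fun i => fr_aug F (f i)); split=> //.
have aug0 : fr_aug F (fr_d F 0 w) = 0 by apply/fr_exact0; exists w.
rewrite -zE -z'E -[LHS]subr0 -{1}aug0 -linearB fE linear_sum.
by apply: eq_bigr => i _; rewrite linearZ.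
Qed.

Section BoundedDegree.
Variables (j : 'I_n) (aj : int).

(** Induction on the total degree: if [b_j > aj], then [v] is a combination of variables times
    elements of smaller total degree; otherwise only generators with [gam i] at most [aj] at [j] can
    occur. *)
Lemma bounded_generators : finitely_generated M ->
  (forall b, aj < b ord0 j -> betti M 0 b 0) ->
  exists (r : nat) (gam : 'I_r -> deg) (g : 'I_r -> M),
    [/\ forall i, gm_deg (gam i) (g i), generates g &
        forall i, gam i ord0 j <= aj].
Proof.
move=> /homogeneous_generators[r [gam [g [gdeg gen]]]] bet.
have [low lowP] := total_lower_bound gam.
(* Discarded generators become 0, which has every degree; [const_mx aj] is one that respects the
   bound. *)
pose g' i := if gam i ord0 j <= aj then g i else 0.
pose gam' i : deg := if gam i ord0 j <= aj then gam i else const_mx aj.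
have hom (N : nat) b v : total b < low + N%:Z -> gm_deg b v -> in_span g' v.
  elim: N b v => [|N IHN] b v bN bv.
    (* The total degree of [b] is below that of every generator, so all the monomials vanish. *)
    have [c vE] := gen v; move: (bv); rewrite vE => /(homogeneous_combination gdeg) ->.
    apply: in_span_sum => i _; rewrite /mono; case: ifP => [/total_ge0|_].
      by rewrite totalB; have := lowP i; move: bN => /=; lia.
    by rewrite scaler0 scale0r; apply: in_span0.
  have [bj|bj] := leP (b ord0 j) aj.
    have [c vE] := gen v; move: (bv); rewrite vE => /(homogeneous_combination gdeg) ->.
    exists (fun i => coefd (b - gam i) (c i) *: mono k (b - gam i)).
    apply: eq_bigr => i _; rewrite /mono; case: ifP => [/forallP/(_ j)|_].
      rewrite !mxE subr_ge0 => ij; congr (_ *: _); rewrite /g' ifT //.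
      exact: le_trans ij bj.
    by rewrite scaler0 !scale0r.
  have [w wdeg ->] := homogeneous_maxideal_mul bv (betti0_maxideal_mul (bet _ bj) bv).
  apply: in_span_sum => l _; apply: in_spanZ; apply: IHN (wdeg l).
  by rewrite totalB total_U; move: bN => /=; lia.
exists r, gam', g'; split=> [i|v|i].
- by rewrite /gam' /g'; case: ifP => // _; apply: gm_deg0.
- have [s [f [fdeg ->]]] := gm_deg_span v; apply: in_span_sum => b _.
  by have [N bN] := lt_low_bound low (total b); apply: hom bN (fdeg b).
- by rewrite /gam'; case: ifP => // _; rewrite mxE.
Qed.

Section Relations.
Variables (r : nat) (gam : 'I_r -> deg) (g : 'I_r -> M).
Hypothesis gdeg : forall i, gm_deg (gam i) (g i).
Hypothesis gen : generates g.
Hypothesis gamj : forall i, gam i ord0 j <= aj.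

(* The degree [b] part of the kernel of the map from the graded free module on
   generators of degrees [gam i] onto [M]; a multiple of the monomial of degree
   [b - gam i] is recorded by its coefficient, so multiplication by a monomial
   becomes an inclusion between these spaces. *)
Definition relation b (c : 'I_r -> k) :=
  (forall i, c i != 0 -> nonneg (b - gam i)) /\
  \sum_i (c i *: mono k (b - gam i)) *: g i = 0.

Lemma relation_ext b c c' : c =1 c' -> relation b c -> relation b c'.
Proof.
move=> cc' [cge crel]; split=> [i|]; first by rewrite -cc'; apply: cge.
by rewrite -[RHS]crel; apply: eq_bigr => i _; rewrite cc'.
Qed.

Lemma relation_sum b (c : 'I_n -> 'I_r -> k) :
  (forall l, relation b (c l)) -> relation b (fun i => \sum_l c l i).
Proof.
move=> crel; split=> [i|].
  apply: contraNT => bi; rewrite big1 // => l _; apply/eqP; apply: contraNT bi.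
  by have [cge _] := crel l; apply: cge.
under eq_bigr => i _ do rewrite scaler_suml scaler_suml.
by rewrite exchange_big big1 // => l _; have [] := crel l.
Qed.

Lemma relationX b (u : 'X_{1..n}) c :
  (forall i, c i != 0 -> nonneg (b - gam i)) ->
  \sum_i (c i *: mono k (b + mnm_degree u - gam i)) *: g i =
  'X_[u] *: \sum_i (c i *: mono k (b - gam i)) *: g i.
Proof.
move=> cge; rewrite scaler_sumr; apply: eq_bigr => i _.
have [->|ci] := eqVneq (c i) 0; first by rewrite !scale0r scaler0.
by rewrite addrAC monoD ?cge // scalerA scalerAr.
Qed.

Lemma relationD b (u : 'X_{1..n}) c :
  relation b c -> relation (b + mnm_degree u) c.
Proof.
move=> [cge crel]; split=> [i ci|]; last by rewrite relationX // crel scaler0.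
by rewrite addrAC; apply/nonnegD/cge.
Qed.

(** The relation lifts to [y] in [F_0]. Vanishing of [Tor_1] writes [y] as a sum of variables times
    boundaries, and these are carried back to relations among the [g i]. *)
Lemma betti1_relation b c : aj < b ord0 j -> betti M 1 b 0 -> relation b c ->
  exists2 c' : 'I_n -> 'I_r -> k,
    forall l, relation (b - mnm_degree U_(l)) (c' l) &
    forall i, c i = \sum_l c' l i.
Proof.
move=> bj [F [e [_ span _]]] [cge crel].
have /(functional_choice _)[f fP] i :
    exists f, gm_deg (gam i) f /\ fr_aug F f = g i.
  have [z zE] := fr_aug_surj F (g i).
  have [|f fdeg fE] :=
    homogeneous_lift (z := z) (@fr_aug_deg _ _ _ F) (b := gam i).
    by rewrite zE.
  by exists f; rewrite fE.
(* As [gam i] is at most [aj], hence less than [b], at [j], every coefficient is divisible by [x_j].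
   So [y] lies in [m F_0], and a preimage of it in [F_1] is a cycle for [Tor_1]. *)
have cmono i : c i *: mono k (b - gam i) =
    'X_j * (c i *: mono k (b - mnm_degree U_(j) - gam i)).
  have [->|ci] := eqVneq (c i) 0; first by rewrite !scale0r mulr0.
  rewrite -scalerAr addrAC -mono_subU ?cge // !mxE subr_gt0.
  exact: le_lt_trans (gamj i) bj.
pose y := \sum_i (c i *: mono k (b - gam i)) *: f i.
have ydeg : gm_deg b y.
  by apply: gm_deg_sum => i _; apply: gm_deg_mono; have [] := fP i.
have /fr_exact0[u uE] : fr_aug F y = 0.
  rewrite linear_sum -[RHS]crel; apply: eq_bigr => i _.
  by rewrite linearZ /=; have [_ ->] := fP i.
have [|x xdeg xE] := homogeneous_lift (z := u) (@fr_d_deg _ _ _ F 0) (b := b).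
  by rewrite uE.
have yE := etrans xE uE.
have [|c0] := span x.
  split=> //; rewrite yE; exists r, (fun i => c i *: mono k (b - gam i)), f.
  by split=> // i; rewrite cmono; apply: in_maxidealM.
rewrite big_ord0 subr0 => -[_ [w [_ /in_maxideal_mulP[h xwE]]]].
have {}yE : y = \sum_l 'X_l *: fr_d F 0 (h l).
  have dd0 : fr_d F 0 (fr_d F 1 w) = 0 by apply/fr_exact; exists w.
  rewrite -yE -[LHS]subr0 -[X in _ - X]dd0 -linearB xwE linear_sum.
  by apply: eq_bigr => l _; rewrite linearZ.
(* [F_0] need not be free on the [g i]; [phi] lifts its augmentation through the evaluation of row
   vectors at the [g i]. *)
have [J [eJ [_ spanJ freeJ]]] := fr_free F 0.
have /(functional_choice _)[t tP] q :
    exists t : 'rV[S]_r, fr_aug F (eJ q) = \sum_i t ord0 i *: g i.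
  have [t tE] := gen (fr_aug F (eJ q)).
  by exists (\row_i t i); rewrite tE; apply: eq_bigr => i _; rewrite mxE.
have [phi phiE] := free_lift t spanJ freeJ.
pose eval (x : 'rV[S]_r) : M := \sum_i x ord0 i *: g i.
have evalD : {morph eval : x x' / x + x'}.
  by move=> x1 x2; rewrite -big_split; apply: eq_bigr => i _; rewrite mxE scalerDl.
have evalZ q : {morph eval : x / q *: x}.
  by move=> x1; rewrite scaler_sumr; apply: eq_bigr => i _; rewrite mxE scalerA.
have eval0 : eval 0 = 0.
  by rewrite /eval big1 // => i _; rewrite mxE scale0r.
have evalN x1 : eval (- x1) = - eval x1.
  by apply/eqP; rewrite -addr_eq0 -evalD addNr eval0.
have phiP z : eval (phi z) = fr_aug F z.
  have [s [cs ->]] := spanJ z; rewrite !linear_sum (big_morph _ evalD eval0).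
  by apply: eq_bigr => q _; rewrite !linearZ /= evalZ phiE tP.
have eval_delta i : eval (delta_mx ord0 i) = g i.
  rewrite /eval (bigD1 i) //= mxE !eqxx scale1r big1 ?addr0 // => i' /negPf ii'.
  by rewrite mxE ii' andbF scale0r.
(* [phi (f i)] and the unit vector both evaluate to [g i], so [kap i] is a syzygy. Its coefficient
   has a factor [x_j], so the correction goes into [rho j]. *)
pose kap i := phi (f i) - delta_mx ord0 i.
have kapP i : eval (kap i) = 0.
  by rewrite evalD evalN phiP eval_delta; have [_ ->] := fP i; rewrite subrr.
pose rho l : 'rV[S]_r := phi (fr_d F 0 (h l)) -
  if l == j then \sum_i (c i *: mono k (b - mnm_degree U_(j) - gam i)) *: kap i
  else 0.
have rhoP l : eval (rho l) = 0.
  rewrite evalD evalN phiP; have -> : fr_aug F (fr_d F 0 (h l)) = 0.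
    by apply/fr_exact0; exists (h l).
  case: ifP => _; rewrite ?eval0 ?subrr // (big_morph _ evalD eval0).
  by rewrite big1 ?subrr // => i _; rewrite evalZ kapP scaler0.
have cE : \sum_i (c i *: mono k (b - gam i)) *: delta_mx ord0 i =
    \sum_l 'X_l *: rho l :> 'rV[S]_r.
  transitivity (phi y - \sum_i (c i *: mono k (b - gam i)) *: kap i).
    rewrite linear_sum -sumrB; apply: eq_bigr => i _.
    by rewrite linearZ /= -scalerBr /kap subKr.
  rewrite yE linear_sum; under [RHS]eq_bigr => l _ do rewrite scalerBr.
  rewrite sumrB; congr (_ - _).
    by apply: eq_bigr => l _; rewrite linearZ.
  rewrite [RHS](bigD1 j) //= eqxx [X in _ + X]big1 ?addr0.
    by rewrite scaler_sumr; apply: eq_bigr => i _; rewrite cmono scalerA.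
  by move=> l /negPf->; rewrite scaler0.
(* Only the part of [rho l] in degree [b - e_l] is kept. *)
exists (fun l i => coefd (b - mnm_degree U_(l) - gam i) (rho l ord0 i)) => [l|i].
  split=> [i|]; first by apply: contraNT => /coefd_eq0->.
  rewrite -homogeneous_combination //; first exact: rhoP.
  by have := rhoP l; rewrite /eval => ->; apply: gm_deg0.
have [ci|ci] := boolP (nonneg (b - gam i)); last first.
  rewrite big1 => [|l _]; first by apply/eqP; apply: contraNT ci; apply: cge.
  by rewrite addrAC -coefd_XM coefd_eq0.
have := congr1 (fun x : 'rV[S]_r => coefd (b - gam i) (x ord0 i)) cE.
rewrite /= !summxE coefd_sum (bigD1 i) //= !mxE !eqxx mulr1 coefdZ_mono //.
rewrite big1 ?addr0 => [->|i' /negPf ii'].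
  by rewrite coefd_sum; apply: eq_bigr => l _; rewrite mxE coefd_XM addrAC.
by rewrite !mxE eq_sym ii' andbF mulr0 /coefd ci mcoeff0.
Qed.

Hypothesis bet1 : forall b, aj < b ord0 j -> betti M 1 b 0.

(** Induction on the total degree. In the decomposition of [c] the part for [l = j] already lives in
    degree [b - e_j]. For [l <> j] the degree [b - e_l] has the same [j]-th coordinate, so induction
    removes [e_j], and multiplication by [x_l] restores [e_l]. *)
Lemma relation_descent b c :
  aj < b ord0 j -> relation b c -> relation (b - mnm_degree U_(j)) c.
Proof.
have [low lowP] := total_lower_bound gam.
have [N] := lt_low_bound low (total b).
elim: N b c => [|N IHN] b c bN bj brel.
  have c0 i : c i = 0.
    apply/eqP; apply/negP => /negP/(proj1 brel)/total_ge0; rewrite totalB.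
    by have := lowP i; move: bN => /=; lia.
  split=> [i|]; first by rewrite c0 eqxx.
  by rewrite big1 // => i _; rewrite c0 !scale0r.
have [c' c'rel cE] := betti1_relation bj (bet1 bj) brel.
apply: relation_ext (fsym cE) _; apply: relation_sum => l.
have [->//|lj] := eqVneq l j.
have -> : b - mnm_degree U_(j) =
    b - mnm_degree U_(l) - mnm_degree U_(j) + mnm_degree U_(l).
  by rewrite addrAC subrK.
apply/relationD/IHN => //; first by rewrite totalB total_U; move: bN => /=; lia.
by rewrite !mxE mnm1E (negPf lj) subr0.
Qed.

(** [v] and [x_j v] share one coefficient vector, so [x_j v = 0] is a relation in degree [b + e_j],
    which descends to degree [b]. *)
Lemma mulX_inj_of_generators b v :
  aj <= b ord0 j -> gm_deg b v -> 'X_j *: v = 0 -> v = 0.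
Proof.
move=> bj bv; have [p vE] := gen v.
move: (bv); rewrite vE => /(homogeneous_combination gdeg)->.
set c := fun i => coefd (b - gam i) (p i).
have cge i : c i != 0 -> nonneg (b - gam i).
  by apply: contraNT => ?; rewrite /c coefd_eq0.
rewrite -relationX // => xv.
have [] : relation (b + mnm_degree U_(j) - mnm_degree U_(j)) c.
  apply: relation_descent; first by rewrite !mxE mnm1E eqxx ltzD1.
  by split=> // i /cge; rewrite addrAC; apply: nonnegD.
by rewrite addrK.
Qed.

(** Every [gam i] is less than [b + e_j] at [j], so each monomial occurring in [v] can be divided by
    [x_j]. *)
Lemma mulX_surj_of_generators b v :
  aj <= b ord0 j -> gm_deg (b + mnm_degree U_(j)) v ->
  exists2 w, gm_deg b w & v = 'X_j *: w.
Proof.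
move=> bj bv; have [p vE] := gen v.
pose c i := coefd (b + mnm_degree U_(j) - gam i) (p i).
exists (\sum_i (c i *: mono k (b - gam i)) *: g i).
  by apply: gm_deg_sum => i _; apply: gm_deg_mono.
move: (bv); rewrite vE => /(homogeneous_combination gdeg)->.
apply: relationX => i; apply: contraNT => bi; apply/eqP/coefd_eq0.
apply: contraNN bi => bi; rewrite -(addrK (mnm_degree U_(j)) b) addrAC.
apply: nonneg_subU => //; rewrite !mxE mnm1E eqxx.
by have := gamj i; move: bj => /=; lia.
Qed.

End Relations.
End BoundedDegree.

Lemma mulX_bijective_of_betti (j : 'I_n) (aj : int) : finitely_generated M ->
  (forall i b, aj < b ord0 j -> betti M i b 0) ->
  forall b, aj <= b ord0 j ->
    (forall v, gm_deg b v -> 'X_j *: v = 0 -> v = 0) /\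
    (forall v, gm_deg (b + mnm_degree U_(j)) v ->
       exists2 w, gm_deg b w & v = 'X_j *: w).
Proof.
move=> fg bet b bj.
have [r [gam [g [gdeg gen gamj]]]] := bounded_generators fg (bet 0%N).
split=> v; first exact: mulX_inj_of_generators (bet 1%N) _ _ bj.
exact: mulX_surj_of_generators bj.
Qed.

Lemma mulXn_bijective_of_betti (j : 'I_n) (aj : int) : finitely_generated M ->
  (forall i b, aj < b ord0 j -> betti M i b 0) ->
  forall (t : nat) b, aj <= b ord0 j ->
    (forall v, gm_deg b v -> 'X_[U_(j) *+ t] *: v = 0 -> v = 0) /\
    (forall v, gm_deg (b + mnm_degree (U_(j) *+ t)%MM) v ->
       exists2 w, gm_deg b w & v = 'X_[U_(j) *+ t] *: w).
Proof.
move=> fg bet; have bij := mulX_bijective_of_betti fg bet.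
elim=> [|t IHt] b bj.
  rewrite mulm0n mnm_degree0 addr0 mpolyX0; split=> v; first by rewrite scale1r.
  by exists v; rewrite ?scale1r.
have bj' : aj <= (b + mnm_degree U_(j)) ord0 j.
  by rewrite !mxE mnm1E eqxx; move: bj => /=; lia.
have [inj1 surj1] := bij b bj; have [injt surjt] := IHt _ bj'.
rewrite mulmSr mpolyXD; split=> v bv; rewrite -?scalerA.
  move=> xv0; apply: inj1 => //; apply: injt xv0; exact: gm_degX.
have [|w bw ->] := surjt v.
  by rewrite -addrA -mnm_degreeD addmC.
by have [w' bw' ->] := surj1 w bw; exists w'; rewrite // scalerA.
Qed.

End Presentation.

(** * Monomial ideals as graded modules *)

(** These are the exponent sets of monomial ideals. *)
Record mnm_upset n := MnmUpset {
  upset_pred :> pred 'X_{1..n};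
  upset_addP : forall u v, upset_pred u -> upset_pred (u + v)%MM
}.

Section MonomialIdeal.
Variables (k : fieldType) (n : nat).
Local Notation S := {mpoly k[n]}.
Local Notation deg := 'rV[int]_n.

Section Ideal.
Variable U : mnm_upset n.

Definition in_monideal : {pred S^o} := [pred p : S | all U (msupp p)].

Lemma in_monidealP (p : S) :
  reflect (forall u, u \in msupp p -> U u) (p \in in_monideal).
Proof. exact: allP. Qed.

Lemma in_monideal_submod_closed : submod_closed in_monideal.
Proof.
split=> [|a p q /in_monidealP pU /in_monidealP qU]; apply/in_monidealP => u.
  by rewrite msupp0.
move=> /msuppD_le; rewrite mem_cat => /orP[|/qU//].
move=> /msuppM_le/allpairsP[[v w] /= [_ /pU wU ->]]; rewrite addmC.
exact: upset_addP.
Qed.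

HB.instance Definition _ :=
  GRing.isSubmodClosed.Build S S^o in_monideal in_monideal_submod_closed.

Record monideal := MonIdeal { monideal_val : S^o; _ : monideal_val \in in_monideal }.

HB.instance Definition _ := [isSub for monideal_val].
HB.instance Definition _ := [Choice of monideal by <:].
HB.instance Definition _ := [SubChoice_isSubZmodule of monideal by <:].
HB.instance Definition _ := [SubZmodule_isSubLmodule of monideal by <:].

Variable c : deg.

(** The ideal is graded as a submodule of the shift [S(-c)], where 1 has degree [c]. *)
Definition monideal_deg (b : deg) (p : monideal) : Prop :=
  forall u, u \in msupp (\val p : S) -> c + mnm_degree u = b.

Lemma monideal_deg0 b : monideal_deg b 0.
Proof. by move=> u; rewrite raddf0 msupp0. Qed.

Lemma monideal_degD b p q :
  monideal_deg b p -> monideal_deg b q -> monideal_deg b (p + q).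
Proof.
move=> bp bq u; rewrite raddfD => /msuppD_le.
by rewrite mem_cat => /orP[/bp|/bq].
Qed.

Lemma monideal_degZ b (a : k) (u : 'X_{1..n}) p :
  monideal_deg b p -> monideal_deg (b + mnm_degree u) ((a *: 'X_[u] : S) *: p).
Proof.
move=> bp v; rewrite linearZ /= => /msuppM_le/allpairsP[[x w] /= [xu /bp <- ->]].
by move/msuppZ_le: xu; rewrite msuppX inE => /eqP->; rewrite mnm_degreeD addrAC addrA.
Qed.

Definition poly_part (b : deg) (p : S) : S :=
  \sum_(u <- msupp p | c + mnm_degree u == b) p@_u *: 'X_[u].

Lemma msupp_poly_part b p u :
  u \in msupp (poly_part b p) -> u \in msupp p /\ c + mnm_degree u = b.
Proof.
move=> /msupp_sum_le/flattenP[s /mapP[v]]; rewrite mem_filter => /andP[/eqP vb vp ->].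
by move=> /msuppZ_le; rewrite msuppX inE => /eqP->.
Qed.

Lemma poly_part_monideal b (p : monideal) : poly_part b (\val p) \in in_monideal.
Proof.
apply/in_monidealP => u /msupp_poly_part[up _].
by have /in_monidealP := valP p; apply.
Qed.

Lemma monideal_deg_span (p : monideal) :
  exists (s : seq deg) (f : deg -> monideal),
    (forall b, monideal_deg b (f b)) /\ p = \sum_(b <- s) f b.
Proof.
exists (undup [seq c + mnm_degree u | u <- msupp (\val p : S)]).
exists (fun b => MonIdeal (poly_part_monideal b p)); split.
  by move=> b u /msupp_poly_part[].
apply: val_inj; rewrite raddf_sum /= /poly_part (exchange_big_dep xpredT) //=.
rewrite [LHS]mpolyE; apply: eq_big_seq => u up.
rewrite big_mkcond (bigD1_seq (c + mnm_degree u)) ?undup_uniq //=; last first.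
  by rewrite mem_undup; apply/mapP; exists u.
by rewrite eqxx big1 ?addr0 // => b; rewrite eq_sym => /negPf->.
Qed.

Lemma monideal_deg_free (s : seq deg) (f : deg -> monideal) :
  uniq s -> (forall b, monideal_deg b (f b)) -> \sum_(b <- s) f b = 0 ->
  forall b, b \in s -> f b = 0.
Proof.
move=> us fdeg f0 b bs; apply: val_inj; rewrite raddf0.
apply/mpolyP => u; rewrite mcoeff0.
have [ub|] := boolP (u \in msupp (\val (f b) : S)); last first.
  by rewrite -mcoeff_eq0 => /eqP.
have := congr1 (fun p : monideal => (\val p : S)@_u) f0.
rewrite raddf_sum (raddf0 val) mcoeff0 raddf_sum /= (bigD1_seq b) //=.
rewrite big1 ?addr0 // => d db.
apply/eqP; rewrite mcoeff_eq0; apply: contraNN db => /fdeg <-.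
by rewrite (fdeg _ _ ub).
Qed.

Definition graded_monideal : gradedModule k n :=
  @GradedModule k n monideal monideal_deg monideal_deg0 monideal_degD
    monideal_degZ monideal_deg_span monideal_deg_free.

End Ideal.

(** The [k]-linear extension of [w] from monomials; by [monomial_extM] it is [S]-linear on a
    monomial ideal where [w] respects multiplication by monomials. *)
Definition monomial_ext (V : lmodType S) (w : 'X_{1..n} -> V) (p : S) : V :=
  \sum_(u <- msupp p) (p@_u)%:MP *: w u.

Section MonomialExt.
Variables (V : lmodType S) (w : 'X_{1..n} -> V).
Local Notation ext := (monomial_ext w).

Lemma monomial_ext_widen (s : seq 'X_{1..n}) (p : S) :
  uniq s -> {subset msupp p <= s} -> ext p = \sum_(u <- s) (p@_u)%:MP *: w u.
Proof.
move=> us ps; rewrite (bigID (mem (msupp p))) /= [X in _ + X]big1 ?addr0; last first.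
  by move=> u; rewrite -mcoeff_eq0 => /eqP->; rewrite mpolyC0 scale0r.
rewrite -big_filter; apply: perm_big; apply: uniq_perm; rewrite ?filter_uniq //.
move=> u; rewrite mem_filter andbC.
by case: (boolP (u \in msupp p)) => [/ps->|]; rewrite ?andbF.
Qed.

Lemma monomial_extD : {morph ext : p q / p + q}.
Proof.
move=> p q; pose s := undup (msupp p ++ msupp q ++ msupp (p + q)).
have us : uniq s by apply: undup_uniq.
rewrite !(@monomial_ext_widen s) // => [|u|u|u];
  try by rewrite mem_undup !mem_cat => ->; rewrite ?orbT.
by rewrite -big_split; apply: eq_bigr => u _; rewrite mcoeffD mpolyCD scalerDl.
Qed.

Lemma monomial_ext0 : ext 0 = 0.
Proof. by rewrite /monomial_ext msupp0 big_nil. Qed.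

Lemma monomial_extZX (a : k) u : ext (a *: 'X_[u]) = a%:MP *: w u.
Proof.
rewrite (@monomial_ext_widen [:: u]) //; last first.
  by move=> v /msuppZ_le; rewrite msuppX.
by rewrite big_seq1 mcoeffZ mcoeffX eqxx mulr1.
Qed.

Lemma monomial_extX u : ext 'X_[u] = w u.
Proof. by rewrite -[X in ext X]scale1r monomial_extZX mpolyC1 scale1r. Qed.

Lemma monomial_extM (U : mnm_upset n) (p q : S) :
  (forall u v, U u -> w (v + u)%MM = 'X_[v] *: w u) ->
  p \in in_monideal U -> ext (q * p) = q *: ext p.
Proof.
move=> wX /in_monidealP pU.
rewrite {1}(mpolyE p) mulr_sumr (big_morph _ monomial_extD monomial_ext0).
rewrite [RHS]scaler_sumr; apply: eq_big_seq => u /pU uU.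
rewrite {1}(mpolyE q) {3}(mpolyE q) mulr_suml scaler_suml.
rewrite (big_morph _ monomial_extD monomial_ext0); apply: eq_bigr => v _.
have -> : q@_v *: 'X_[v] * (p@_u *: 'X_[u]) = (q@_v * p@_u) *: 'X_[v + u] :> S.
  by rewrite mpolyXD -scalerAl -scalerAr scalerA.
rewrite monomial_extZX wX // !scalerA; congr (_ *: _).
by rewrite mpolyCM -!mul_mpolyC; ring.
Qed.

End MonomialExt.
End MonomialIdeal.

(** * Divisibility in injective modules *)

Lemma power_upset_subproof n (t : nat) (L : seq 'I_n) (u v : 'X_{1..n}) :
  has (fun m => t <= u m)%N L -> has (fun m => t <= (u + v)%MM m)%N L.
Proof.
move=> /hasP[m mL um]; apply/hasP; exists m => //.
by rewrite mnmDE (leq_trans um) ?leq_addr.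
Qed.

(** The corresponding ideal is generated by the [x_m^t] with [m] in [L]. *)
Definition power_upset n t (L : seq 'I_n) := MnmUpset (@power_upset_subproof n t L).

Definition full_upset n := @MnmUpset n xpredT (fun _ _ _ => isT).

Section Divisibility.
Variables (k : fieldType) (n : nat).
Local Notation S := {mpoly k[n]}.
Local Notation deg := 'rV[int]_n.

Definition killed (A : gradedModule k n) (t : nat) (L : seq 'I_n) (v : A) :=
  forall m, m \in L -> 'X_[U_(m) *+ t] *: v = 0.

Lemma mpolyX_dvd (u v : 'X_{1..n}) : (v <= u)%MM ->
  'X_[u] = 'X_[u - v] * 'X_[v] :> S.
Proof. by move=> vu; rewrite -mpolyXD submK. Qed.

Lemma mulmn_le (t : nat) (m : 'I_n) (u : 'X_{1..n}) :
  (U_(m) *+ t <= u)%MM = (t <= u m)%N.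
Proof.
apply/mnm_lepP/idP => [/(_ m)|um l]; first by rewrite mulmnE mnm1E eqxx mul1n.
by rewrite mulmnE mnm1E; case: eqP => [<-|_]; rewrite ?mul1n ?mul0n.
Qed.

(* The map sending [x_l^t] to [y] and each [x_m^t], [m \in L], to [0] is well
   defined on the ideal these monomials generate; the image of [1] under an
   extension of it to the whole ring is the required quotient. *)
Lemma injective_divisible (E : gradedModule k n) (t : nat) (L : seq 'I_n)
    (l : 'I_n) (c : deg) (y : E) :
  graded_injective E -> (0 < t)%N -> l \notin L ->
  gm_deg (c + mnm_degree (U_(l) *+ t)%MM) y -> killed t L y ->
  exists y', [/\ gm_deg c y', killed t L y' & 'X_[U_(l) *+ t] *: y' = y].
Proof.
move=> injE t0 lL ydeg yL.
pose U := power_upset t (l :: L).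
pose w (u : 'X_{1..n}) : E := if (t <= u l)%N then 'X_[u - U_(l) *+ t] *: y else 0.
have wX u v : U u -> w (v + u)%MM = 'X_[v] *: w u.
  rewrite /w; have [ul _|ul] := leqP t (u l).
    rewrite mnmDE (leq_trans ul) ?leq_addl // scalerA -mpolyXD.
    by congr ('X_[_] *: _); apply/mnmP=> i; rewrite !(mnmDE, mnmBE) addnBA // mulmnE
      mnm1E; case: eqP => [<-|_]; rewrite ?mul1n ?mul0n.
  (* Some [x_m^t] with [m] in [L] divides [x^u]. As [m <> l], it still divides the quotient of
     [x^(v + u)] by [x_l^t], and it kills [y]. *)
  rewrite /= leqNgt ul scaler0 => /hasP[m mL um]; case: ifP => // _.
  rewrite (@mpolyX_dvd _ (U_(m) *+ t)) ?mulmn_le; last first.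
    rewrite mnmBE mulmnE mnm1E mnmDE; case: eqP => [lm|_].
      by rewrite lm mL in lL.
    by rewrite mul0n subn0 (leq_trans um) ?leq_addl.
  by rewrite -scalerA yL // scaler0.
pose A := graded_monideal k U c; pose B := graded_monideal k (full_upset n) c.
have inB (p : S) : p \in in_monideal (full_upset n) by apply/in_monidealP.
pose h0 (p : A) : B := MonIdeal (inB (\val p)).
have h_lin : linear h0.
  by move=> a p q; apply: val_inj.
pose h : {linear A -> B} := HB.pack h0 (GRing.isLinear.Build _ _ _ _ h0 h_lin).
pose f0 (p : A) : E := monomial_ext w (\val p).
have f_lin : linear f0.
  move=> a p q; rewrite /f0 linearP monomial_extD.
  by congr (_ + _); apply: monomial_extM wX (valP p).
pose f : {linear A -> E} := HB.pack f0 (GRing.isLinear.Build _ _ _ _ f0 f_lin).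
have hdeg : degree_preserving h by move=> b p bp.
have wdeg u : gm_deg (c + mnm_degree u) (w u).
  rewrite /w; case: ifP => [ul|_]; last exact: gm_deg0.
  rewrite -{1}(@submK _ (U_(l) *+ t) u) ?mulmn_le // addmC mnm_degreeD addrA.
  exact: gm_degX.
have fdeg : degree_preserving f.
  move=> b p bp; rewrite /= /f0 /monomial_ext big_seq_cond.
  by apply: gm_deg_sum => u; rewrite andbT => /bp <-; apply: gm_degC.
have h_inj : injective h by move=> p q [] /val_inj.
have [g [gdeg gh]] := injE A B h f hdeg fdeg h_inj.
pose one : B := MonIdeal (inB 1).
have gX m : m \in l :: L -> 'X_[U_(m) *+ t] *: g one = w (U_(m) *+ t)%MM.
  move=> mL; have XmU : ('X_[U_(m) *+ t] : S) \in in_monideal U.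
    apply/in_monidealP => u; rewrite msuppX inE => /eqP->.
    by apply/hasP; exists m => //; rewrite mulmnE mnm1E eqxx mul1n.
  rewrite -linearZ -(monomial_extX w).
  transitivity (f (MonIdeal XmU)) => //; rewrite -gh; congr (g _).
  by apply: val_inj; rewrite linearZ /=; apply: mulr1.
exists (g one); split.
- apply: gdeg => u; rewrite /= msupp1 inE => /eqP->.
  by rewrite mnm_degree0 addr0.
(* The exponent of [x_m^t] at [l] is 0, less than [t], so [w] sends it to 0. *)
- move=> m mL; rewrite gX ?inE ?mL ?orbT // /w mulmnE mnm1E.
  by have [ml|_] := eqVneq m l; [rewrite -ml mL in lL | rewrite mul0n leqNgt t0].
- rewrite gX ?mem_head // /w mulmnE mnm1E eqxx mul1n leqnn.
  suff -> : (U_(l) *+ t - U_(l) *+ t)%MM = 0%MM by rewrite mpolyX0 scale1r.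
  by apply/mnmP=> i; rewrite mnmBE subnn mnm0E.
Qed.

End Divisibility.

(** * Exactness of the strands *)

Section AugmentedComplex.
Variables (k : fieldType) (n : nat) (M : gradedModule k n).
Variable I : injective_resolution M.
Local Notation S := {mpoly k[n]}.
Local Notation deg := 'rV[int]_n.

(** With [M] in position 0 the complex is exact everywhere; exactness there is injectivity of the
    augmentation. *)
Definition aug_mod (i : nat) : gradedModule k n := if i is i'.+1 then I i' else M.

Definition aug_d (i : nat) : {linear aug_mod i -> aug_mod i.+1} :=
  match i with 0%N => ir_aug I | i'.+1 => ir_d I i' end.

Definition aug_boundary (P : forall i, aug_mod i -> Prop) (i : nat) :
    aug_mod i -> Prop :=
  match i with
  | 0%N => fun z => z = 0
  | i'.+1 => fun z => exists2 w, P i' w & aug_d i' w = z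
  end.

Definition exact_on (P : forall i, aug_mod i -> Prop) :=
  forall i z, P i z -> aug_d i z = 0 -> aug_boundary P z.

Definition strand (t : nat) (L : seq 'I_n) (c : deg) (i : nat) (z : aug_mod i) :=
  gm_deg c z /\ killed t L z.

Lemma aug_d_deg i : degree_preserving (aug_d i).
Proof. by case: i => [|i]; [exact: ir_aug_deg | exact: ir_d_deg]. Qed.

Lemma aug_dd i z : aug_d i.+1 (aug_d i z) = 0.
Proof.
case: i z => [|i] z; first by apply/ir_exact0; exists z.
by apply/ir_exact; exists z.
Qed.

Lemma strand_nil_exact t c : exact_on (strand t [::] c).
Proof.
move=> [|i] z [zdeg _] dz.
  by apply: (@ir_aug_inj _ _ _ I); rewrite dz raddf0.
have [w wE] : exists w, aug_d i w = z.
  by case: i z {zdeg} dz => [|i] z; [move/ir_exact0 | move/ir_exact].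
have [|w' w'deg w'E] := homogeneous_lift (z := w) (@aug_d_deg i) (b := c).
  by rewrite wE.
by exists w'; rewrite ?w'E.
Qed.

(* The next strand is the kernel of a surjection between two exact strands. *)
Lemma strand_cons_exact t L l c :
  exact_on (strand t L c) ->
  exact_on (strand t L (c + mnm_degree (U_(l) *+ t)%MM)) ->
  (forall i (y : aug_mod i), strand t L (c + mnm_degree (U_(l) *+ t)%MM) y ->
     exists2 y', strand t L c y' & 'X_[U_(l) *+ t] *: y' = y) ->
  exact_on (strand t (l :: L) c).
Proof.
move=> exL exL' surj.
have strandX i (y : aug_mod i) : strand t L c y ->
    strand t L (c + mnm_degree (U_(l) *+ t)%MM) ('X_[U_(l) *+ t] *: y).
  move=> [ydeg yL]; split; first exact: gm_degX.
  by move=> m /yL ym; rewrite scalerA mulrC -scalerA ym scaler0.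
have strand_cons i (y : aug_mod i) :
    strand t L c y -> 'X_[U_(l) *+ t] *: y = 0 -> strand t (l :: L) c y.
  by move=> [ydeg yL] yl; split=> // m; rewrite inE => /orP[/eqP->|/yL].
move=> i z [zdeg zL] dz.
have zl : 'X_[U_(l) *+ t] *: z = 0 by apply: zL; rewrite mem_head.
have {zdeg zL}zP : strand t L c z.
  by split=> // m mL; apply: zL; rewrite inE mL orbT.
have := exL _ _ zP dz; case: i z zl zP dz => [|i] z zl zP dz //= [w wP wz].
have : aug_d i ('X_[U_(l) *+ t] *: w) = 0 by rewrite linearZ /= wz.
move=> /(exL' _ _ (strandX _ _ wP)).
case: i z zl zP dz w wP wz => [|i] z zl zP dz w wP wz /=.
  by move=> xw0; exists w => //; apply: strand_cons.
(* Now [x_l^t w = d v] and [v = x_l^t u], so [w - d u] is killed by [x_l^t] and still maps to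
   [z]. *)
move=> [v vP vw]; have [u [udeg uL] uv] := surj _ _ vP.
have [wdeg wL] := wP.
exists (w - aug_d i u); last by rewrite linearB /= wz -/(aug_d i.+1) aug_dd subr0.
apply: strand_cons; last by rewrite scalerBr -vw -uv linearZ subrr.
split; first by apply: gm_degB => //; apply: aug_d_deg.
by move=> m mL; rewrite scalerBr wL // -linearZ uL // raddf0 subrr.
Qed.

(** [rcons] keeps [j] innermost, so that the induction on [L] starts with it. *)
Lemma strand_exact (j : 'I_n) (aj : int) t : (0 < t)%N ->
  (forall b : deg, aj <= b ord0 j ->
    (forall v : M, gm_deg b v -> 'X_[U_(j) *+ t] *: v = 0 -> v = 0) /\
    (forall v : M, gm_deg (b + mnm_degree (U_(j) *+ t)%MM) v ->
       exists2 w, gm_deg b w & v = 'X_[U_(j) *+ t] *: w)) ->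
  forall (L : seq 'I_n) (c : deg), uniq (rcons L j) -> aj <= c ord0 j ->
  exact_on (strand t (rcons L j) c).
Proof.
move=> t0 bij.
have shift l (c : deg) : aj <= c ord0 j ->
    aj <= (c + mnm_degree (U_(l) *+ t)%MM) ord0 j.
  by move=> cj; rewrite !mxE; move: cj => /=; lia.
elim=> [|l L IHL] c.
  move=> _ cj; apply: strand_cons_exact; try exact: strand_nil_exact.
  move=> [|i] y [ydeg yL].
    by have [_ /(_ y ydeg)[w wdeg ->]] := bij c cj; exists w.
  have [y' [? ? <-]] :=
    injective_divisible (@ir_inj _ _ _ I i) t0 (isT : j \notin [::]) ydeg yL.
  by exists y'.
rewrite rcons_cons => /andP[lL uL] cj; apply: strand_cons_exact.
- exact: IHL.
- by apply: IHL => //; apply: shift.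
move=> [|i] y [ydeg yL]; last first.
  have [y' [? ? <-]] :=
    injective_divisible (@ir_inj _ _ _ I i) t0 lL ydeg yL.
  by exists y'.
(* In position 0 the condition at [j] is already imposed, and [x_j^t] is injective on [M] in this
   degree. *)
suff -> : y = 0.
  by exists 0; [split; [exact: gm_deg0 | move=> m _] |]; rewrite scaler0.
have [inj _] := bij _ (shift l c cj); apply: inj ydeg _.
by apply: yL; rewrite mem_rcons mem_head.
Qed.

End AugmentedComplex.

(** * Torsion and powers of the variables *)

Section Torsion.
Variables (k : fieldType) (n : nat) (A : gradedModule k n).
Local Notation S := {mpoly k[n]}.

Lemma torsion_killed (v : A) :
  maxideal_torsion v -> exists2 t, (0 < t)%N & forall L, killed t L v.
Proof.
(* The successor keeps the exponent positive even for [t = 0]. *)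
move=> [t tors]; exists t.+1 => // L m _.
rewrite -mpolyXn exprS -scalerA.
have := tors (fun=> 'X_m); rewrite prodr_const card_ord => -> //; last first.
  by move=> _; rewrite -[X in in_maxideal X]mulr1; apply: in_maxidealM.
exact: scaler0.
Qed.

(** Expanding one factor in the variables leaves the other factors acting on the [x_j v], which
    monomials of degree one less annihilate. *)
Lemma maxideal_prod_eq0 (N : nat) (v : A) :
  (forall u : 'X_{1..n}, (N <= mdeg u)%N -> 'X_[u] *: v = 0) ->
  forall p : 'I_N -> S, (forall l, in_maxideal (p l)) -> (\prod_l p l) *: v = 0.
Proof.
elim: N v => [|N IHN] v vN p pm.
  by rewrite big_ord0 -mpolyX0 vN.
have [q qE] := pm ord0; rewrite big_ord_recl mulrC -scalerA qE scaler_suml.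
rewrite scaler_sumr big1 // => j _; rewrite -scalerA scalerA mulrC -scalerA.
rewrite IHN ?scaler0 // => u uN.
by rewrite scalerA -mpolyXD vN // mdegD mdeg1 addn1.
Qed.

(** Pigeonhole: a monomial of degree greater than [n * t] has some exponent at least [t]. *)
Lemma killed_torsion t (v : A) : (forall m, 'X_[U_(m) *+ t] *: v = 0) ->
  maxideal_torsion v.
Proof.
move=> vt; exists (n * t).+1; apply: maxideal_prod_eq0 => u uN.
have [/existsP[m um]|/existsPn small] := boolP [exists m, (t <= u m)%N].
  by rewrite (@mpolyX_dvd _ _ _ (U_(m) *+ t)) ?mulmn_le // -scalerA vt scaler0.
suff : (mdeg u <= n * t)%N by rewrite leqNgt uN.
rewrite mdegE -[X in (_ <= X * _)%N]card_ord -sum_nat_const; apply: leq_sum => m _.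
by rewrite ltnW // ltnNge small.
Qed.

End Torsion.

Theorem lemma3p9 (k : fieldType) (n : nat) (M : gradedModule k n)
    (a : 'rV[int]_n) :
  finitely_generated M ->
  (forall (i : nat) (b : 'rV[int]_n), ~ betti M i b 0 -> coord_le b a) ->
  forall (i : nat) (c : 'rV[int]_n),
    local_cohomology_nonzero M i c -> coord_le c (a - const_mx 1).
Proof.
move=> fg bet i c [I [z [[zdeg ztors dz] znb]]] j.
have bet_j i' (b : 'rV[int]_n) : a ord0 j < b ord0 j -> betti M i' b 0.
  by move=> aj; apply: NNPP => /bet/(_ j); rewrite leNgt aj.
rewrite !mxE leNgt; apply/negP => cj; apply: znb.
have {}cj : a ord0 j <= c ord0 j by move: cj => /=; lia.
have [t t0 zt] := torsion_killed ztors.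
(* All variables, with [j] last as [strand_exact] requires. *)
pose L := rcons (filter (predC1 j) (enum 'I_n)) j.
have Lall m : m \in L by rewrite mem_rcons inE mem_filter mem_enum /= andbT orbN.
have uL : uniq L by rewrite rcons_uniq mem_filter /= eqxx filter_uniq ?enum_uniq.
have ex := strand_exact (I := I) t0 (mulXn_bijective_of_betti fg bet_j t) uL cj.
(* Position [i + 1] of the augmented complex is [I^i]. *)
have [w [wdeg wL] wz] := ex i.+1 z (conj zdeg (zt L)) dz.
case: i z zdeg ztors dz zt w wdeg wL wz => [|i] z zdeg ztors dz zt w wdeg wL wz.
  (* For [i = 0] the element [w] lies in [M] and is killed by [x_j^t], so [w = 0] and [z = 0]. *)
  have [inj _] := mulXn_bijective_of_betti fg bet_j t cj.
  by rewrite -wz (inj w) ?raddf0 //; apply: wL; rewrite mem_rcons mem_head.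
by exists w; split=> //; apply: (@killed_torsion _ _ _ t) => m; apply: wL; apply: Lall.
Qed.
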